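(* Let $X$ be a Hausdorff SDL space. Then $$|X|\leq 2^{t(X)\cdot H\psi(X)}\leq 2^{\chi(X)},$$ where $t(X)$ is the tightness, $H\psi(X)$ the Hausdorff pseudocharacter, and $\chi(X)$ the character of $X$.
   Context: All cardinal invariants are taken to be infinite cardinals. A space is Lindelöf if every open cover has a countable subcover (no separation axiom is included). Strongly discrete: a subset $D$ of a topological space $X$ is strongly discrete if there is a family $\{W_d:d\in D\}$ of pairwise disjoint open subsets of $X$ (indexed by $D$) with $d\in W_d$ for every $d\in D$. SDL space: $X$ is an SDL space if the closure $\overline{D}$ in $X$ is Lindelöf for every strongly discrete subset $D$ of $X$. Tightness: for $x\in X$, $t(x,X)$ is the least infinite cardinal $\kappa$ such that whenever $A\subseteq X$ and $x\in\overline{A}$, there is $B\subseteq A$ with $|B|\leq\kappa$ and $x\in\overline{B}$; $t(X)=\sup\{t(x,X):x\in X\}$. Character: for $x\in X$, $\chi(x,X)$ is the least infinite cardinal $\kappa$ such that $x$ has a local base of cardinality at most $\kappa$; $\chi(X)=\sup\{\chi(x,X):x\in X\}$. Hausdorff pseudocharacter: for Hausdorff $X$, $H\psi(X)$ is the least infinite cardinal $\kappa$ for which one can assign to each $x\in X$ a family $\mathcal N_x$ of open neighborhoods of $x$, with $|\mathcal N_x|\leq\kappa$, such that whenever $x\neq y$ there are $U\in\mathcal N_x$ and $V\in\mathcal N_y$ with $U\cap V=\varnothing$. *)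

(* Defs.v *)
From mathcomp Require Import all_boot all_order all_classical.
From mathcomp Require Import topology.

Set Implicit Arguments.
Unset Strict Implicit.
Unset Printing Implicit Defensive.

Local Open Scope classical_set_scope.
Local Open Scope card_scope.

(* A cardinal is represented by a type, up to equipotence; cardinals are
   compared by [#<=] on the corresponding full sets. *)

Definition least_infinite_spec (P : Type -> Prop) (K : Type) : Prop :=
  [/\ infinite_set [set: K], P K
    & forall L : Type, infinite_set [set: L] -> P L -> [set: K] #<= [set: L]].

(* The default value [nat] is only taken when no infinite cardinal satisfies
   P; see [least_infiniteP]. *)
Definition least_infinite (P : Type -> Prop) : Type :=
  if pselect (exists K : Type, least_infinite_spec P K) is left exK
  then projT1 (cid exK) else nat.

Definition infinite_sup (I : Type) (F : I -> Type) : Type :=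
  least_infinite (fun K => forall i, [set: F i] #<= [set: K]).

Definition card_mul (K L : Type) : Type := (K * L)%type.

Definition card_pow2 (K : Type) : Type := K -> bool.

Definition strongly_discrete (X : topologicalType) (D : set X) : Prop :=
  exists W : X -> set X,
    (forall d, D d -> open_nbhs d (W d)) /\ trivIset D W.

Definition lindelof (X : topologicalType) : Prop :=
  forall C : set (set X), C `<=` open -> \bigcup_(U in C) U = [set: X] ->
    exists S : set (set X),
      [/\ S `<=` C, countable S & \bigcup_(U in S) U = [set: X]].

(* [set_type A] carries the subspace topology induced by X. *)
Definition SDL_space (X : topologicalType) : Prop :=
  forall D : set X, strongly_discrete D -> lindelof (set_type (closure D)).

Definition tightness_at_le (X : topologicalType) (x : X) (K : Type) : Prop :=
  forall A : set X, closure A x ->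
    exists B : set X, [/\ B `<=` A, B #<= [set: K] & closure B x].

Definition tightness_at (X : topologicalType) (x : X) : Type :=
  least_infinite (tightness_at_le x).

Definition tightness (X : topologicalType) : Type :=
  infinite_sup (fun x : X => tightness_at x).

Definition local_base (X : topologicalType) (x : X) (B : set (set X)) : Prop :=
  B `<=` open_nbhs x /\
  forall V, open_nbhs x V -> exists2 U, B U & U `<=` V.

Definition character_at_le (X : topologicalType) (x : X) (K : Type) : Prop :=
  exists2 B : set (set X), local_base x B & B #<= [set: K].

Definition character_at (X : topologicalType) (x : X) : Type :=
  least_infinite (character_at_le x).

Definition character (X : topologicalType) : Type :=
  infinite_sup (fun x : X => character_at x).

Definition Hpseudocharacter_le (X : topologicalType) (K : Type) : Prop :=
  exists N : X -> set (set X),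
    [/\ forall x, N x `<=` open_nbhs x,
        forall x, N x #<= [set: K]
      & forall x y, x <> y ->
          exists U V, [/\ N x U, N y V & U `&` V = set0]].

Definition Hpseudocharacter (X : topologicalType) : Type :=
  least_infinite (@Hpseudocharacter_le X).

(* The default value in [least_infinite] is never taken in the definitions
   above, provided X is Hausdorff in the case of [Hpseudocharacter]: see
   [infinite_supP], [tightness_atP], [character_atP], [HpseudocharacterP]. *)

Lemma inj_card_leT (A B : Type) (f : A -> B) :
  injective f -> [set: A] #<= [set: B].
Proof.
move=> injf; rewrite -(card_le_eql (inj_card_eq (in2W injf))).
exact: subset_card_le.
Qed.

Lemma card_leT_inj (A B : Type) :
  [set: A] #<= [set: B] -> exists f : A -> B, injective f.
Proof.
move=> /card_leP[f].
exists (fun a => set_val (f (SigSub (mem_set (I : [set: A] a))))) => a b.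
move=> /val_inj /(@inj _ _ _ f) h.
by have := h (mem_set I) (mem_set I) => /(congr1 val).
Qed.

Lemma infinite_sumr_nat (A : Type) : infinite_set [set: (A + nat)%type].
Proof.
apply/infiniteP; apply: (@inj_card_leT nat (A + nat)%type inr).
by move=> m n [].
Qed.

(* Take a maximal set of points of the product on which every projection is
   injective: by maximality some projection is onto. *)
Lemma card_le_min (T I : Type) (F : I -> set T) :
  inhabited I -> exists i, forall j, F i #<= F j.
Proof.
move=> [i0].
pose good (S : set (I -> T)) :=
  (forall f, S f -> forall i, F i (f i)) /\
  (forall i f g, S f -> S g -> f i = g i -> f = g).
have [S [[Sin Sinj] Smax]] : exists A, good A /\ forall B, A `<` B -> ~ good B.
  apply: Zorn_bigcup => C Cgood Ctot; split.
    by move=> f [A CA Af] i; exact: (Cgood _ CA).1.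
  move=> i f g [A CA Af] [B CB Bg] fg.
  have [AB|BA] := Ctot _ _ CA CB.
  - exact: (Cgood _ CB).2 i f g (AB _ Af) Bg fg.
  - exact: (Cgood _ CA).2 i f g Af (BA _ Bg) fg.
have [i Fi] : exists i, F i `<=` [set f i | f in S].
  apply: contrapT => noi.
  have ex i : exists t, F i t /\ ~ [set f i | f in S] t.
    apply: contrapT => not; apply: noi; exists i => t Fit.
    by apply: contrapT => nSt; apply: not; exists t.
  have [g gP] := choice ex.
  apply: (Smax (S `|` [set g])).
    split; first by move=> f; left.
    move=> /(_ g (or_intror erefl)) Sg.
    by have [_] := gP i0; apply; exists g.
  split=> [f [Sf|->] i|i f h]; [exact: Sin|exact: (gP i).1|].
  move=> [Sf|->] [Sh|->] // fh; first exact: (Sinj i).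
  - by have [_ []] := gP i; exists f.
  - by have [_ []] := gP i; exists h.
exists i => j; apply: (card_le_trans (subset_card_le Fi)).
apply: (card_le_trans (card_image_le _ _)).
have injj : {in S &, injective (fun f : I -> T => f j)}.
  by move=> f g; rewrite !inE; exact: Sinj.
rewrite -(card_le_eql (inj_card_eq injj)).
by apply: subset_card_le => _ [f Sf <-]; exact: Sin.
Qed.

Lemma card_leT_total (A B : Type) :
  [set: A] #<= [set: B] \/ [set: B] #<= [set: A].
Proof.
pose F (b : bool) : set (A + B) := if b then range inl else range inr.
have eA : range (@inl A B) #= [set: A].
  by apply: inj_card_eq => a b _ _ [].
have eB : range (@inr A B) #= [set: B].
  by apply: inj_card_eq => a b _ _ [].
have [[] h] := @card_le_min _ _ F (inhabits true).
  by left; have := h false; rewrite /F (card_le_eql eA) (card_le_eqr eB).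
by right; have := h true; rewrite /F (card_le_eql eB) (card_le_eqr eA).
Qed.

Lemma least_infinite_ex (P : Type -> Prop) (K : Type) :
  infinite_set [set: K] -> P K -> exists L, least_infinite_spec P L.
Proof.
move=> infK PK.
pose Q (A : set K) := exists L, [/\ infinite_set [set: L], P L & [set: L] #= A].
have QK : Q setT by exists K; split.
have [[A [L [infL PL LA]]] Amin] :=
  @card_le_min K {A | Q A} (fun A => sval A) (inhabits (exist Q _ QK)).
exists L; split=> // M infM PM; rewrite (card_le_eql LA).
have [/card_leT_inj[f injf]|KM] := card_leT_total M K.
  have Mf : [set: M] #= range f.
    by apply: card_esym; apply: inj_card_eq => a b _ _; exact: injf.
  have QM : Q (range f) by exists M.
  by rewrite (card_le_eqr Mf); exact: (Amin (exist Q _ QM)).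
apply: card_le_trans KM; exact: (Amin (exist Q _ QK)).
Qed.

Lemma least_infiniteP (P : Type -> Prop) (K : Type) :
  infinite_set [set: K] -> P K -> least_infinite_spec P (least_infinite P).
Proof.
move=> infK PK; rewrite /least_infinite; case: pselect => [exK|].
  by case: cid.
by case; exact: least_infinite_ex infK PK.
Qed.

Lemma infinite_supP (I : Type) (F : I -> Type) :
  least_infinite_spec (fun K => forall i, [set: F i] #<= [set: K])
    (infinite_sup F).
Proof.
apply: (@least_infiniteP _ ({i & F i} + nat)%type).
  exact: infinite_sumr_nat.
move=> i; apply: (@inj_card_leT _ _ (fun a => inl (existT F i a))).
move=> a b /(congr1 (fun u => if u is inl v then v else existT F i a)) E.
have := projT2_eq E.
by rewrite (Prop_irrelevance (projT1_eq E) erefl).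
Qed.

Lemma set_card_leT (T : Type) (A : set T) : A #<= [set: (T + nat)%type].
Proof.
apply: (card_le_trans (subset_card_le (@subsetT _ A))).
by apply: (@inj_card_leT _ _ inl) => a b [].
Qed.

Lemma tightness_atP (X : topologicalType) (x : X) :
  least_infinite_spec (tightness_at_le x) (tightness_at x).
Proof.
apply: (@least_infiniteP _ (X + nat)%type); first exact: infinite_sumr_nat.
by move=> A Ax; exists A; split=> //; exact: set_card_leT.
Qed.

Lemma character_atP (X : topologicalType) (x : X) :
  least_infinite_spec (character_at_le x) (character_at x).
Proof.
apply: (@least_infiniteP _ (set X + nat)%type); first exact: infinite_sumr_nat.
exists (open_nbhs x); last exact: set_card_leT.
by split=> // V xV; exists V.
Qed.

Lemma HpseudocharacterP (X : topologicalType) : hausdorff_space X ->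
  least_infinite_spec (@Hpseudocharacter_le X) (Hpseudocharacter X).
Proof.
rewrite open_hausdorff => hX.
apply: (@least_infiniteP _ (set X + nat)%type); first exact: infinite_sumr_nat.
exists (@open_nbhs X); split=> [x|x|x y /eqP /hX[[U V] /=]].
- by [].
- exact: set_card_leT.
- by move=> [/set_mem Ux /set_mem Vy] [oU oV /eqP UV]; exists U, V; split; [split|split|].
Qed.

(* Main.v *)
From Stdlib Require Import Wellfounded.
Require Import Defs.
From mathcomp Require Import all_boot all_order all_classical.
From mathcomp Require Import topology wochoice.

Set Implicit Arguments.
Unset Strict Implicit.
Unset Printing Implicit Defensive.

Local Open Scope classical_set_scope.
Local Open Scope card_scope.

(** Write [K] for [t(X) * Hpsi(X)].

    The second inequality holds because both factors are at most the character,
    and an infinite cardinal equals its square ([infinite_square]).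

    The first one is a closing-off argument. Fix for every point [x] open
    neighbourhoods [n x k], [k : K], such that distinct points are separated by
    disjoint members of the two families. A point of the closure of a set of
    size at most [K] is determined by the traces of its neighbourhoods
    [n x k] on that set, so that closures of sets of size at most [K] have size
    at most [2^K] ([covered_closure]). Iterating [K^+] times produces a set [H]
    of size at most [2^K] which contains the closure of each of its subsets of
    size at most [K], hence is closed by tightness, and which is moreover not
    contained in any union of [K] closures of unions of [K] chosen
    neighbourhoods of its points, unless this union is the whole space
    ([hull_closed_set]).

    It remains to see that [H] is everything ([hull_closed_setT]). If [p] is not
    in [H], choose for [x] in [H] an open neighbourhood [U x] which is disjoint
    from a neighbourhood [n p k] of [p], and call this [k] the colour of [x].
    For any [F] included in [H] with at most [K] points, the union over all
    colours [k] of the closure of the union of the [U x], for [x] in [F] of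
    colour [k], misses [p], hence misses a point of [H]. This allows one to
    choose [K^+] points [d a] of [H], each one outside the union so obtained
    from a set [F a] of size at most [K], where [F a] increases with [a],
    contains all previous points, and is such that the [U x] with [x] in [F a]
    cover the closure of the set of points of each colour chosen before stage
    [a]. The last
    requirement can be met: the points of one colour form a strongly discrete
    set, as [U (d a)] minus the closure of the earlier [U x] of the same colour
    witnesses, so their closure is Lindelof, and countably many points of [H]
    per colour suffice. Since the tightness is at most [K], the closure of the
    set of all chosen points of a given colour is still covered by the [U x]
    with [x] in some [F a]; by the Lindelof property countably many [x] are
    enough, and taking them for all colours gives at most [K] points, which lie
    in a single [F a]. Then [d a] lies in some [U x] with [x] in [F a],
    contradicting its choice. *)

(** * Squares of infinite cardinals *)

Lemma card_le_inj (T U : Type) (u0 : U) (A : set T) (B : set U) : A #<= B ->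
  exists f : T -> U, (forall x, A x -> B (f x)) /\
    (forall x y, A x -> A y -> f x = f y -> x = y).
Proof.
move=> /card_leP[f].
exists (fun x => if pselect (A x) is left Ax
  then set_val (f (SigSub (mem_set Ax))) else u0); split=> [x Ax|x y Ax Ay].
  by case: pselect => // Ax'; exact: set_valP.
case: pselect => // Ax'; case: pselect => // Ay' /val_inj E.
by have /(congr1 val) := @inj _ _ _ f _ _ (mem_set I) (mem_set I) E.
Qed.

Section squaring.
Variable K : Type.

(** The underlying set of a partial pairing, recovered from its graph. *)
Definition diag (G : set (K * K * K)) : set K := [set a | exists c, G (a, a, c)].

(** Graphs of injections from [A * A] to [A], for a subset [A] of [K]. As sets
    of triples they are ordered by inclusion, so that Zorn's lemma applies. *)
Definition pairing_graph (G : set (K * K * K)) : Prop :=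
  [/\ forall a b c, G (a, b, c) -> [/\ diag G a, diag G b & diag G c],
      forall a b, diag G a -> diag G b -> exists c, G (a, b, c),
      forall a b c c', G (a, b, c) -> G (a, b, c') -> c = c'
    & forall a b a' b' c, G (a, b, c) -> G (a', b', c) -> a = a' /\ b = b'].

Lemma pairing_graph_bigcup (F : set (set (K * K * K))) :
  F `<=` pairing_graph -> total_on F subset ->
  pairing_graph (\bigcup_(G in F) G).
Proof.
move=> Fp Ftot.
have two p q : (\bigcup_(G in F) G) p -> (\bigcup_(G in F) G) q ->
    exists G, [/\ F G, G p & G q].
  move=> [G FG Gp] [G' FG' Gq]; have [GG'|G'G] := Ftot _ _ FG FG'.
    by exists G'; split=> //; exact: GG'.
  by exists G; split=> //; exact: G'G.
have diagS G : F G -> diag G `<=` diag (\bigcup_(G in F) G).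
  by move=> FG a [c Gc]; exists c, G.
split.
- move=> a b c [G FG Gabc]; have [/(_ _ _ _ Gabc)[Ga Gb Gc] _ _ _] := Fp _ FG.
  by split; exact: (diagS G FG).
- move=> a b [c ac] [d bd]; have [G [FG Ga Gb]] := two _ _ ac bd.
  have [_ Gt _ _] := Fp _ FG.
  have [|//|e Ge] := Gt a b; first by exists c.
    by exists d.
  by exists e, G.
- move=> a b c c' ac ac'; have [G [FG Ga Gb]] := two _ _ ac ac'.
  by have [_ _ Gf _] := Fp _ FG; exact: Gf Ga Gb.
- move=> a b a' b' c ac ac'; have [G [FG Ga Gb]] := two _ _ ac ac'.
  by have [_ _ _ Gi] := Fp _ FG; exact: Gi Ga Gb.
Qed.

(** A set [A] with an injective pairing absorbs a disjoint set that injects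
    into it: two points of [A] serve as tags for a sum. *)
Lemma pairing_absorb (G : set (K * K * K)) (B : set K) (u v : K) :
  pairing_graph G -> diag G u -> diag G v -> u <> v ->
  B #<= diag G ->
  exists e : K -> K,
    (forall x, (diag G `|` B) x -> diag G (e x)) /\
    (forall x y, (diag G `|` B) x -> (diag G `|` B) y -> e x = e y -> x = y).
Proof.
move=> [Gd Gt Gf Gi] Gu Gv uv /(card_le_inj u)[h [hB hinj]].
have /choice[m mP] : forall p : K * K, exists c,
    diag G p.1 -> diag G p.2 -> G (p.1, p.2, c).
  move=> [a b] /=; have [Ga|] := pselect (diag G a); last by exists u.
  have [Gb|] := pselect (diag G b); last by exists u.
  by have [c Gc] := Gt _ _ Ga Gb; exists c.
exists (fun x => if pselect (diag G x) then m (u, x) else m (v, h x)); split.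
  move=> x Ax; case: pselect => [Gx|nGx].
    by have [] := Gd _ _ _ (mP (u, x) Gu Gx).
  have Bx : B x by case: Ax.
  by have [] := Gd _ _ _ (mP (v, h x) Gv (hB _ Bx)).
move=> x y Ax Ay.
case: pselect => [Gx|nGx]; case: pselect => [Gy|nGy] /= E.
- have := mP (u, y) Gu Gy; rewrite -E => Gy'.
  by have [] := Gi _ _ _ _ _ (mP (u, x) Gu Gx) Gy'.
- have By : B y by case: Ay.
  have := mP (v, h y) Gv (hB _ By); rewrite -E => Gy'.
  by have [] := Gi _ _ _ _ _ (mP (u, x) Gu Gx) Gy'.
- have Bx : B x by case: Ax.
  have := mP (v, h x) Gv (hB _ Bx); rewrite E => Gx'.
  by have [] := Gi _ _ _ _ _ (mP (u, y) Gu Gy) Gx'.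
- have By : B y by case: Ay.
  have Bx : B x by case: Ax.
  have := mP (v, h y) Gv (hB _ By); rewrite -E => Gy'.
  have [_] := Gi _ _ _ _ _ (mP (v, h x) Gv (hB _ Bx)) Gy'.
  exact: hinj.
Qed.

(** Take a maximal pairing graph on a set [A] which extends a given pairing of a
    countable subset. If the complement of [A] were as large as [A], it would
    contain a copy [B] of [A] into which the pairs of [A `|` B] that are not
    pairs of [A] inject, and the pairing would extend. Hence the complement is
    at most as large as [A], so that [K] injects into [A]. *)
Lemma infinite_square : infinite_set [set: K] ->
  exists f : K * K -> K, injective f.
Proof.
move=> /infiniteP/card_leT_inj[j jinj].
have [j2 j2inj] : exists f : nat * nat -> nat, injective f.
  by exists choice.pickle; exact: (pcan_inj choice.pickleK).
pose G0 : set (K * K * K) :=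
  [set p | exists m n, p = (j m, j n, j (j2 (m, n)))].
have diag0 : diag G0 = range j.
  apply/seteqP; split=> [a [c [m [n [-> _ _]]]]|_ [n _ <-]]; first by exists m.
  by exists (j (j2 (n, n))), n, n.
have pair0 : pairing_graph G0.
  split; rewrite ?diag0.
  - by move=> a b c [m [n [-> -> ->]]]; split; eexists.
  - by move=> _ _ [m _ <-] [n _ <-]; exists (j (j2 (m, n))), m, n.
  - move=> a b c c' [m [n [-> -> ->]]] [m' [n' [/jinj mm' /jinj nn' ->]]].
    by rewrite mm' nn'.
  - by move=> a b a' b' c [m [n [-> -> ->]]] [m' [n' [-> -> /jinj/j2inj[-> ->]]]].
(* The alternative [G = set0] accounts for the union of the empty chain. *)
have [G [[pairG GG0] Gmax]] : exists G, (pairing_graph G /\ (G = set0 \/ G0 `<=` G))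
    /\ forall H, G `<` H -> ~ (pairing_graph H /\ (H = set0 \/ G0 `<=` H)).
  apply: Zorn_bigcup => F Fp Ftot; split.
    by apply: pairing_graph_bigcup => // G /Fp[].
  have [[G FG G0G]|nG] := pselect (exists2 G, F G & G0 `<=` G).
    by right=> p /G0G Gp; exists G.
  left; apply/seteqP; split=> // p [G FG Gp].
  have [_ [G0'|G0G]] := Fp _ FG; first by rewrite G0' in Gp.
  by case: nG; exists G.
have {}GG0 : G0 `<=` G.
  case: GG0 => // G0E; exfalso; apply: (Gmax G0); last by split=> //; right.
  rewrite G0E properEneq; split=> //.
  apply/eqP => E; have : G0 (j 0, j 0, j (j2 (0, 0))) by exists 0, 0.
  by rewrite -E.
have Gj n : diag G (j n) by exists (j (j2 (n, n))); apply: GG0; exists n, n.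
have j01 : j 0 <> j 1 by move=> /jinj.
have absorb B := @pairing_absorb G B _ _ pairG (Gj 0) (Gj 1) j01.
have [Gd Gt Gf Gi] := pairG.
have /choice[m mP] : forall p : K * K, exists c,
    diag G p.1 -> diag G p.2 -> G (p.1, p.2, c).
  move=> [a b] /=; have [Ga|] := pselect (diag G a); last by exists (j 0).
  have [Gb|] := pselect (diag G b); last by exists (j 0).
  by have [c Gc] := Gt _ _ Ga Gb; exists c.
pose F (b : bool) := if b then diag G else ~` diag G.
have [[] /= h] := @card_le_min _ _ F (inhabits true); last first.
  (* The complement is absorbed, so [K] itself injects into [diag G]. *)
  have [e [eG einj]] := absorb _ (h true).
  have eG' x : diag G (e x) by apply: eG; have [] := pselect (diag G x); [left|right].
  exists (fun p => m (e p.1, e p.2)) => -[x y] [x' y'] /= E.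
  have := mP (e x', e y') (eG' _) (eG' _); rewrite -E => Gx'.
  have [Ex Ey] := Gi _ _ _ _ _ (mP (e x, e y) (eG' _) (eG' _)) Gx'.
  have allG z : (diag G `|` ~` diag G) z by have [] := pselect (diag G z); [left|right].
  by congr pair; apply: einj.
(* Otherwise the complement contains a copy [B] of [diag G], and the pairing
   extends to [diag G `|` B], the new pairs being sent into [B]. *)
have [g [gG ginj]] := card_le_inj (j 0) (h false).
pose B := g @` diag G.
have [e [eG einj]] : exists e : K -> K,
    (forall x, (diag G `|` B) x -> diag G (e x)) /\
    (forall x y, (diag G `|` B) x -> (diag G `|` B) y -> e x = e y -> x = y).
  exact/absorb/card_image_le.
pose A' := diag G `|` B.
pose new : set (K * K * K) := [set p | exists x y, [/\ A' x, A' y,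
  ~ (diag G x /\ diag G y) & p = (x, y, g (m (e x, e y)))]].
have mG x y : A' x -> A' y -> diag G (m (e x, e y)).
  by move=> A'x A'y; have [] := Gd _ _ _ (mP (e x, e y) (eG _ A'x) (eG _ A'y)).
have nB x : B x -> ~ diag G x by move=> [y Gy <-]; exact: gG.
have diagE : diag (G `|` new) = A'.
  apply/seteqP; split=> [a [c [Ga|[x [y [A'x A'y _ [-> _ _]]]]]]|a A'a] //.
    by left; exists c.
  have [[c Gc]|nGa] := pselect (diag G a); first by exists c; left.
  by exists (g (m (e a, e a))); right; exists a, a; split=> // -[].
exfalso; apply: (Gmax (G `|` new)).
  rewrite properEneq; split; last by move=> p; left.
  apply/eqP => E; have : diag (G `|` new) (g (j 0)) by rewrite diagE; right; exists (j 0).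
  by rewrite -E; exact: gG.
split; last by right=> p /GG0; left.
split; rewrite ?diagE.
- move=> a b c [Gabc|[x [y [A'x A'y _ [-> -> ->]]]]].
    by have [] := Gd _ _ _ Gabc; split; left.
  by split=> //; right; eexists; [exact: mG A'x A'y|].
- move=> a b A'a A'b.
  have [[Ga Gb]|nab] := pselect (diag G a /\ diag G b).
    by have [c Gc] := Gt _ _ Ga Gb; exists c; left.
  by exists (g (m (e a, e b))); right; exists a, b.
- move=> a b c c' [Gc|[x [y [A'x A'y nxy [-> -> ->]]]]].
    move=> [Gc'|[x [y [A'x A'y nxy [ax bx cx]]]]]; first exact: Gf Gc Gc'.
    by have [] := Gd _ _ _ Gc; rewrite ax bx => Gx Gy; case: nxy.
  move=> [Gc'|[x' [y' [A'x' A'y' _ [<- <- ->]]]]] //.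
  by have [] := Gd _ _ _ Gc' => Gx Gy; case: nxy.
- move=> a b a' b' c [Gc|[x [y [A'x A'y _ [-> -> ->]]]]].
    move=> [Gc'|[x [y [A'x A'y nxy [ax bx cx]]]]]; first exact: Gi Gc Gc'.
    have [_ _] := Gd _ _ _ Gc; rewrite cx => /nB[].
    by eexists; [exact: mG A'x A'y|].
  move=> [Gc'|[x' [y' [A'x' A'y' _ [-> -> E]]]]].
    have [_ _] := Gd _ _ _ Gc' => /nB[].
    by eexists; [exact: mG A'x A'y|].
  have E' := ginj _ _ (mG _ _ A'x A'y) (mG _ _ A'x' A'y') E.
  have := mP (e x', e y') (eG _ A'x') (eG _ A'y'); rewrite -E' => Gx'.
  have [Ex Ey] := Gi _ _ _ _ _ (mP (e x, e y) (eG _ A'x) (eG _ A'y)) Gx'.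
  by split; exact: einj.
Qed.
End squaring.

(** * Enumerations *)

(** [covered C A] compares sizes as [A #<= [set: C]] does, but it hands out an
    enumeration of [A] by [C], and such enumerations compose. *)
Definition covered (C T : Type) (A : set T) : Prop :=
  exists f : C -> T, A `<=` range f.

Lemma covered_sub (C T : Type) (A B : set T) :
  A `<=` B -> covered C B -> covered C A.
Proof. by move=> AB [f Bf]; exists f => x /AB /Bf. Qed.

Lemma covered_card (C T : Type) (A : set T) : covered C A -> A #<= [set: C].
Proof.
move=> [f Af]; exact: (card_le_trans (subset_card_le Af) (card_image_le _ _)).
Qed.

Lemma covered_inj (C T : Type) (t0 : T) (A : set T) (g : T -> C) :
  (forall x y, A x -> A y -> g x = g y -> x = y) -> covered C A.
Proof.
move=> ginj.
exists (fun c => if pselect (exists2 x, A x & g x = c) is left e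
  then projT1 (cid2 e) else t0) => x Ax.
exists (g x) => //; case: pselect => [e|[]]; last by exists x.
by case: cid2 => y /= Ay; exact: ginj.
Qed.

Lemma card_covered (C T : Type) (t0 : T) (A : set T) :
  A #<= [set: C] -> covered C A.
Proof.
move=> AC; have [[c0]|nC] := pselect (inhabited C); last first.
  have nA x : ~ A x.
    move/card_leP: AC => [f] Ax; apply: nC; exists.
    exact: set_val (f (SigSub (mem_set Ax))).
  by exists (fun=> t0) => x /nA.
by have [g [_ ginj]] := card_le_inj c0 AC; exact: (covered_inj t0 ginj).
Qed.

Lemma covered_trans (C D T : Type) (A : set T) :
  covered C [set: D] -> covered D A -> covered C A.
Proof.
move=> [f fD] [g gA]; exists (g \o f) => x /gA[d _ <-].
by have [c _ <-] := fD d I; exists c.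
Qed.

Lemma covered_image (C S T : Type) (f : S -> T) (A : set S) :
  covered C A -> covered C (f @` A).
Proof.
by move=> [g gA]; exists (f \o g) => _ [x /gA[c _ <-] <-]; exists c.
Qed.

Lemma covered_bigcup (C I T : Type) (t0 : T) (P : set I) (A : I -> set T) :
  covered C [set: C * C] -> covered C P -> (forall i, P i -> covered C (A i)) ->
  covered C (\bigcup_(i in P) A i).
Proof.
move=> C2 [p pP] cA; apply: (covered_trans C2).
have /choice[e eA] : forall i, exists f : C -> T, P i -> A i `<=` range f.
  move=> i; have [/cA[f fA]|nPi] := pselect (P i); first by exists f.
  by exists (fun=> t0).
exists (fun c => e (p c.1) c.2) => x [i Pi Aix].
have [c _ pc] := pP _ Pi; have [d _ <-] := eA _ Pi _ Aix.
by exists (c, d) => //=; rewrite pc.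
Qed.

Lemma covered_setU (C T : Type) (t0 : T) (A B : set T) :
  covered C [set: C * C] -> covered C [set: bool] ->
  covered C A -> covered C B -> covered C (A `|` B).
Proof.
move=> C2 Cb cA cB.
apply: (@covered_sub _ _ _ (\bigcup_(b in [set: bool]) if b then A else B)).
  by move=> x [Ax|Bx]; [exists true|exists false].
by apply: covered_bigcup => // -[].
Qed.

Lemma cantor (K : Type) : ~ covered K [set: K -> bool].
Proof.
move=> [f fK]; have [k _ E] := fK (fun x => ~~ f x x) I.
by have := congr1 (fun g => g k) E => /=; case: (f k k).
Qed.

(** * Arithmetic of K and of its power *)

Section infinite_cardinal.
Variable K : Type.
Hypothesis infK : infinite_set [set: K].

Lemma infinite_inhabited : inhabited K.
Proof. by have /infiniteP/card_leT_inj[f _] := infK; exists; exact: f 0. Qed.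

Lemma covered_nat : covered K [set: nat].
Proof. by apply: (card_covered 0); exact/infiniteP. Qed.

Lemma covered_countable (T : Type) (t0 : T) (A : set T) :
  countable A -> covered K A.
Proof. by move=> /(card_covered t0); exact: covered_trans covered_nat. Qed.

Lemma covered_bool : covered K [set: bool].
Proof. exact: (covered_countable true). Qed.

Lemma covered_square : covered K [set: K * K].
Proof.
have [k0] := infinite_inhabited; have [f finj] := infinite_square infK.
by apply: (card_covered (k0, k0)); exact: inj_card_leT finj.
Qed.

(** [(2^K)^K = 2^(K * K) = 2^K]. *)
Lemma covered_pow_fun : covered (K -> bool) [set: K -> K -> bool].
Proof.
have [k0] := infinite_inhabited; have [f finj] := infinite_square infK.
exists (fun c a b => c (f (a, b))) => F _.
exists (fun k => `[< exists a b, k = f (a, b) /\ F a b >]) => //.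
apply/funext => a; apply/funext => b; apply/asboolP/idP.
  by move=> [a' [b' [/finj[-> ->]]]].
by move=> Fab; exists a, b.
Qed.

Lemma covered_pow_square :
  covered (K -> bool) [set: (K -> bool) * (K -> bool)].
Proof.
have [b bK] := covered_bool.
apply: (covered_trans covered_pow_fun).
have [k1 _ bk1] := bK true I; have [k0 _ bk0] := bK false I.
exists (fun F => (F k0, F k1)) => -[c d] _.
exists (fun k => if b k then d else c) => //.
by rewrite bk0 bk1.
Qed.

Lemma covered_pow : covered (K -> bool) [set: K].
Proof.
have [k0] := infinite_inhabited.
apply: (card_covered k0); apply: (@inj_card_leT _ _ (fun k l => `[< k = l >])).
move=> k l /(congr1 (fun g => g l)) E; apply: contrapT => kl.
by move: E; rewrite (asboolT (erefl l)) asboolF.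
Qed.

Lemma covered_pow_bool : covered (K -> bool) [set: bool].
Proof. exact: covered_trans covered_pow covered_bool. Qed.

Lemma covered_pow_funs (T : Type) (A : set T) :
  covered (K -> bool) A -> covered (K -> bool) [set f : K -> T | range f `<=` A].
Proof.
move=> [h hA]; apply: (covered_trans covered_pow_fun).
exists (fun F => h \o F) => f fA.
have /choice[F FP] : forall k, exists c, h c = f k.
  by move=> k; have [|c _ <-] := hA (f k); [apply: fA; exists k|exists c].
by exists F => //; apply/funext.
Qed.

End infinite_cardinal.

(** * Transfinite recursion of length the successor of K *)

Lemma well_order_lt (C : Type) : exists lt : C -> C -> Prop,
  [/\ well_founded lt, (forall a b c, lt a b -> lt b c -> lt a c)
    & forall a b, [\/ lt a b, a = b | lt b a]].
Proof.
have [R Rwo] := well_ordering_principle {classic C}.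
have Ras a b : R a b && R b a -> a = b.
  by apply: (@wo_chain_antisymmetric _ R predT (withinW Rwo)).
have minR (A : set C) a : A a -> exists2 z, A z & forall y, A y -> R z y.
  move=> Aa; have [|z [[Az zP] _]] := Rwo [pred x | `[< A x >]].
    by exists a; exact/asboolP.
  by exists z => [|y Ay]; [exact/asboolP|exact/zP/asboolP].
have Rtot a b : R a b \/ R b a.
  by have [|z [->|->] zP] := minR [set a; b] a; [left|left; exact: zP (or_intror _)
    |right; exact: zP (or_introl _)].
exists (fun a b => ~ R b a); split.
- move=> a; apply: contrapT => na.
  have [z nz zP] := minR [set x | ~ Acc (fun a b => ~ R b a) x] a na.
  by apply: nz; constructor => y nzy; apply: contrapT => /zP.
- move=> a b c nba ncb Rca.
  have [|z [[]->|->] zP] := minR [set a; b; c] a; first by left; left.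
  + have Rac := zP c (or_intror erefl).
    have E : a = c by apply: Ras; rewrite Rac.
    by have [] := Rtot a b; rewrite // E.
  + by apply: nba; apply: zP; left; left.
  + by apply: ncb; apply: zP; left; right.
- move=> a b; have [Rba|nba] := pselect (R b a); last by constructor 1.
  have [Rab|nab] := pselect (R a b); last by constructor 3.
  by constructor 2; apply: Ras; rewrite Rab.
Qed.

(** The cardinal [K^+] as a well-ordered type of indices: its segments have
    size at most [K], yet no [K] of its elements are cofinal. *)
Definition successor_order (K T : Type) (lt : T -> T -> Prop) : Prop :=
  [/\ well_founded lt, (forall a b c, lt a b -> lt b c -> lt a c),
      (forall a b, [\/ lt a b, a = b | lt b a]),
      (forall a, covered K [set b | lt b a])
    & forall f : K -> T, exists a, forall k, lt (f k) a].

(** The elements of a well-ordering of [2^K] with at most [K] predecessors form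
    an initial segment. Were it covered by [K], the least element outside, which
    exists by Cantor's theorem, would have at most [K] predecessors too; and a
    cofinal map from [K] would make it a union of [K] sets of size at most
    [K]. *)
Lemma successor_order_ex (K : Type) : infinite_set [set: K] ->
  exists (T : Type) (lt : T -> T -> Prop),
    [/\ successor_order K lt, inhabited T & covered (K -> bool) [set: T]].
Proof.
move=> infK; have K2 := covered_square infK; have Kb := covered_bool infK.
have [lt [wf tr tri]] := well_order_lt (K -> bool).
pose c0 : K -> bool := fun=> true.
pose P (b : K -> bool) := covered K [set c | lt c b \/ c = b].
have ncovP : ~ covered K P.
  move=> covP; apply: (@cantor K); apply: (covered_sub _ covP) => a _.
  elim/(well_founded_ind wf): a => b IH.
  apply: (@covered_sub _ _ _ (P `|` [set b])) => [c [/IH|]|]; [by left|by right|].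
  apply: covered_setU => //; exists (fun=> b) => x ->.
  by have [k] := infinite_inhabited infK; exists k.
have [a0 Pa0] : exists a, P a.
  apply: contrapT => nP; apply: ncovP; exists (fun=> c0) => a Pa.
  by case: nP; exists a.
exists {b | P b}, (fun a b => lt (sval a) (sval b)); split.
- have covle : forall a : {b | P b},
    covered K [set b : {b | P b} | lt (sval b) (sval a) \/ sval b = sval a].
    move=> a; have [f fa] := svalP a.
    exists (fun k => if pselect (P (f k)) is left p then exist P _ p else a).
    move=> [b Pb] /fa[k _ /= fk]; exists k => //.
    case: pselect => [Pfk|]; last by rewrite fk.
    exact: eq_exist.
  split.
  + exact: (wf_inverse_image _ _ lt sval wf).
  + by move=> a b c; exact: tr.
  + move=> [a Pa] [b Pb]; have [ab|E|ba] := tri a b.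
    * by constructor 1.
    * by constructor 2; exact: eq_exist.
    * by constructor 3.
  + by move=> a; apply: (covered_sub _ (covle a)) => b; left.
  + move=> f; apply: contrapT => nf; apply: ncovP.
    have := covered_bigcup (exist P _ Pa0) K2 _ (fun k (_ : [set: K] k) => covle (f k)).
    move=> /(_ (ex_intro _ id (fun k _ => ex_intro2 _ _ k I erefl))).
    move=> /(covered_image sval); apply: covered_sub => b Pb.
    exists (exist P b Pb) => //; apply: contrapT => nb; apply: nf.
    exists (exist P b Pb) => k; have [//|E|ba] := tri (sval (f k)) b.
      by case: nb; exists k => //; right.
    by case: nb; exists k => //; left.
- by exists; exists a0.
- exists (fun c => if pselect (P c) is left p then exist P _ p else exist P _ Pa0).
  move=> [b Pb] _; exists b => //; case: pselect => // Pb'.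
  exact: eq_exist.
Qed.

Lemma wf_recursion (T Y : Type) (lt : T -> T -> Prop) (y0 : Y)
    (Phi : T -> (T -> Y) -> Y) :
  well_founded lt ->
  (forall a h h', (forall b, lt b a -> h b = h' b) -> Phi a h = Phi a h') ->
  exists h, forall a, h a = Phi a h.
Proof.
move=> wf ext.
pose step a (rec : forall b, lt b a -> Y) :=
  Phi a (fun b => if pselect (lt b a) is left p then rec b p else y0).
exists (Fix wf (fun=> Y) step) => a; rewrite Fix_eq.
  by apply: ext => b ba; case: pselect.
move=> b f g fg; apply: ext => c _.
by case: pselect => // p; exact: fg.
Qed.

(** Closing a point under [2^K] operations of arity [K], given together as the
    set-valued [Phi], stops at stage [K^+], since every [K] elements of the
    union already belong to a single stage; and each stage has size at most
    [(2^K)^K = 2^K]. *)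
Lemma closing_off (K T : Type) (t0 : T) (Phi : (K -> T) -> set T) :
  infinite_set [set: K] -> (forall f, covered (K -> bool) (Phi f)) ->
  exists H : set T, [/\ covered (K -> bool) H, H t0
    & forall f, range f `<=` H -> Phi f `<=` H].
Proof.
move=> infK Phic.
have C2 := covered_pow_square infK; have Cb := covered_pow_bool infK.
have CK := covered_pow infK.
have [I [lt [[wf tr tri seg bnd] [i0] CI]]] := successor_order_ex infK.
have [H HE] : exists H : I -> set T, forall a, H a = t0 |`
    \bigcup_(f in [set f | range f `<=` \bigcup_(b in lt^~ a) H b]) Phi f.
  apply: (wf_recursion set0 wf) => a h h' hh'.
  by rewrite (eq_bigcupr hh').
exists (\bigcup_(a in [set: I]) H a); split.
- apply: (covered_bigcup t0) => // a _; elim/(well_founded_ind wf): a => a IH.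
  rewrite HE; apply: covered_setU => //.
    by have [k] := infinite_inhabited infK; exists (fun=> t0) => x ->; exists (fun=> true).
  apply: (covered_bigcup t0) => //.
  apply: (covered_pow_funs infK); apply: (covered_bigcup t0) => //.
  exact: covered_trans CK (seg a).
- by exists i0 => //; rewrite HE; left.
- move=> f fH.
  have /choice[e eP] : forall k, exists a, H a (f k).
    by move=> k; have [|a _ Ha] := fH (f k); [exists k|exists a].
  have [a ae] := bnd e; move=> x fx; exists a => //; rewrite HE; right.
  by exists f => // _ [k _ <-]; exists (e k).
Qed.

(** * Lindelof closures of strongly discrete sets *)

Section SDL.
Variable X : topologicalType.

Lemma strongly_discrete_sub (D E : set X) :
  D `<=` E -> strongly_discrete E -> strongly_discrete D.
Proof.
move=> DE [W [Wn Wt]]; exists W; split=> [d /DE /Wn //|].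
by move=> i j /DE Ei /DE Ej; exact: Wt.
Qed.

Lemma SDL_countable_subcover (D F : set X) (U : X -> set X) :
  SDL_space X -> strongly_discrete D -> (forall x, open (U x)) ->
  closure D `<=` \bigcup_(x in F) U x ->
  exists F', [/\ countable F', F' `<=` F & closure D `<=` \bigcup_(x in F') U x].
Proof.
move=> sdlX Dsd Uo DU.
pose C : set (set (set_type (closure D))) :=
  [set V | exists2 x, F x & V = set_val @^-1` U x].
have Co : C `<=` open by move=> _ [x _ ->]; exists (U x).
have CT : \bigcup_(V in C) V = setT.
  apply/seteqP; split=> // y _; have [x Fx Uy] := DU _ (set_valP y).
  by exists (set_val @^-1` U x) => //; exists x.
have [S [SC Sc ST]] := sdlX D Dsd C Co CT.
have [[x0 Fx0]|nF] := pselect (exists x0, F x0); last first.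
  exists set0; split=> // x /DU[y Fy]; by case: nF; exists y.
have /choice[e eP] : forall V, exists x, S V -> F x /\ V = set_val @^-1` U x.
  move=> V; have [/SC[x Fx VE]|nS] := pselect (S V); first by exists x.
  by exists x0.
exists (e @` S); split.
- exact: card_le_trans (card_image_le _ _) Sc.
- by move=> _ [V /eP[FV _] <-].
- move=> y Dy.
  have [V SV] : (\bigcup_(V in S) V) (SigSub (mem_set Dy)) by rewrite ST.
  by have [_ {1}->] := eP _ SV => /= Uy; exists (e V) => //; exists V.
Qed.

End SDL.

(** * The bound on the number of points *)

Section cardinality_bound.
Variables (X : topologicalType) (K : Type) (n : X -> K -> set X).
Hypotheses (infK : infinite_set [set: K])
  (n_nbhs : forall x k, open_nbhs x (n x k))
  (n_sep : forall x y, x <> y -> exists j k, n x j `&` n y k = set0)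
  (tightK : forall x : X, tightness_at_le x K)
  (sdlX : SDL_space X).

(** The family of traces [f @^-1` n x k] determines [x] within the closure: if
    [n x j] and [n y k] are disjoint, then [n y j `&` n y k] contains some [f i],
    and [i] distinguishes the traces of index [j]. *)
Lemma covered_closure (f : K -> X) : covered (K -> bool) (closure (range f)).
Proof.
have [k0] := infinite_inhabited infK.
apply: (covered_trans (covered_pow_fun infK)).
apply: (covered_inj (f k0) (g := fun x k i => `[< n x k (f i) >])) => x y _ cy E.
apply: contrapT => /n_sep[j [k xy]].
have [|_ [[i _ <-] [yj yk]]] := cy (n y j `&` n y k).
  by apply: filterI; exact: open_nbhs_nbhs.
have /asboolP xj : `[< n x j (f i) >] by rewrite (congr1 (fun g => g j i) E); exact/asboolP.
have : (n x j `&` n y k) (f i) by [].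
by rewrite xy.
Qed.

(** The first component of [g i] selects a neighbourhood of [f i], the second one
    is the colour of [i]. *)
Definition hull (J : Type) (f : J -> X) (g : J -> K * K) (F : set J) : set X :=
  \bigcup_(k in [set: K])
    closure (\bigcup_(i in F `&` [set i | (g i).2 = k]) n (f i) (g i).1).

Lemma sub_hull (J : Type) (f : J -> X) (g : J -> K * K) (F : set J) i :
  F i -> n (f i) (g i).1 `<=` hull f g F.
Proof.
by move=> Fi x nx; exists (g i).2 => //; apply: subset_closure; exists i.
Qed.

(** Over a given [f] there are at most [2^K] hulls, one for each [g], so that a
    point outside each of them can be added while closing off. *)
Lemma hull_closed_set (x0 : X) : exists H : set X,
  [/\ covered (K -> bool) H, H x0, closure H `<=` H
    & forall f g p, range f `<=` H -> ~ hull f g [set: K] p ->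
        exists2 d, H d & ~ hull f g [set: K] d].
Proof.
have C2 := covered_pow_square infK; have Cb := covered_pow_bool infK.
have CK := covered_pow infK.
have /choice[pick pickP] : forall fg : (K -> X) * (K -> K * K), exists d,
    forall p, ~ hull fg.1 fg.2 setT p -> ~ hull fg.1 fg.2 setT d.
  move=> [f g]; have [[d nd]|all] := pselect (exists d, ~ hull f g setT d).
    by exists d.
  by exists x0 => p np; case: all; exists p.
have [|H [HC Hx0 Hop]] := @closing_off K X x0
    (fun f => closure (range f) `|` [set pick (f, g) | g in setT]) infK.
  move=> f; apply: covered_setU => //; first exact: covered_closure.
  apply: covered_image.
  apply: (covered_sub (B := [set g : K -> K * K | range g `<=` setT])) => //.
  by apply: (covered_pow_funs infK); exact: covered_trans CK (covered_square infK).
exists H; split=> //.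
- move=> x /tightK[B [BH /(card_covered x0)[f Bf] cB]].
  (* The enumeration [f] of [B] may leave [H]: stray values become [x0]. *)
  pose f' k := if pselect (H (f k)) then f k else x0.
  apply: (Hop f'); first by move=> _ [k _ <-]; rewrite /f'; case: pselect.
  left; apply: closureS cB => y By; have [k _ fk] := Bf _ By.
  exists k => //; rewrite /f'; case: pselect => //.
  by case; rewrite fk; exact: BH.
- move=> f g p fH np; exists (pick (f, g)); last exact: (pickP (f, g) p).
  by apply: (Hop f) => //; right; exists g.
Qed.

(** A point [p] outside [H] would give rise to [K^+] points [d a] of [H], each
    outside the hull of a set [F d a] that contains the earlier ones. Splitting
    the hull by colour keeps [p] outside, because each colour is a fixed
    neighbourhood of [p], and makes the points of one colour strongly
    discrete. *)
Lemma hull_closed_setT (H : set X) (x0 : X) : H x0 -> closure H `<=` H ->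
  (forall f g p, range f `<=` H -> ~ hull f g [set: K] p ->
        exists2 d, H d & ~ hull f g [set: K] d) ->
  H = [set: X].
Proof.
move=> Hx0 Hcl Hhull; apply/seteqP; split=> // p _; apply: contrapT => nHp.
have K2 := covered_square infK; have Kb := covered_bool infK.
have /choice[w wP] : forall x, exists jk : K * K,
    x <> p -> n x jk.1 `&` n p jk.2 = set0.
  move=> x.
  have [->|/n_sep[j [k jk]]] := pselect (x = p); last by exists (j, k).
  by have [k] := infinite_inhabited infK; exists (k, k).
(* The colour of [x] is [(w x).2]. *)
pose U x := n x (w x).1.
have Uo x : open (U x) by have [] := n_nbhs x (w x).1.
have Ux x : U x x by have [] := n_nbhs x (w x).1.
pose hl F := hull id w F.
have /choice[pick pickP] : forall F, exists d : X,
    covered K F -> F `<=` H -> H d /\ ~ hl F d.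
  move=> F.
  have [[f Ff]|nF] := pselect (covered K F); last by exists p => /nF.
  pose f' k := if pselect (H (f k)) then f k else x0.
  have f'H k : H (f' k) by rewrite /f'; case: (pselect (H (f k))).
  (* [p] is outside the hull: [n p k] misses all neighbourhoods of colour [k]. *)
  have [_ [k _ <-]//||d Hd nd] := Hhull f' (w \o f') p.
    move=> [k _ /(_ (n p k))] [|z [[i [_ /= ik] zi] zp]].
      exact: open_nbhs_nbhs.
    have fp : f' i <> p by move=> E; apply: nHp; rewrite -E.
    have : (n (f' i) (w (f' i)).1 `&` n p (w (f' i)).2) z by rewrite ik.
    by rewrite wP.
  exists d => _ FH; split=> // -[k _ ck]; apply: nd; exists k => //.
  apply: closureS ck => z [x [Fx xk] zx].
  have [i _ fi] := Ff _ Fx.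
  have f'i : f' i = x.
    by rewrite /f'; case: pselect => // -[]; rewrite fi; exact: FH.
  by exists i => /=; rewrite f'i.
have /choice[cov covP] : forall D, exists F : set X, [/\ countable F, F `<=` H
    & strongly_discrete D -> D `<=` H -> closure D `<=` \bigcup_(x in F) U x].
  move=> D.
  have [[sdD DH]|nD] := pselect (strongly_discrete D /\ D `<=` H); last first.
    by exists set0; split=> // sdD DH; case: nD.
  have DU : closure D `<=` \bigcup_(x in H) U x.
    by move=> x /(closureS DH)/Hcl Hx; exists x.
  by have [F [cF FH DF]] := SDL_countable_subcover sdlX sdD Uo DU; exists F.
pose part D k := D `&` [set x | (w x).2 = k].
pose E D := D `|` \bigcup_(k in [set: K]) cov (part D k).
have [I [lt [[wf tr tri seg bnd] [d0] _]]] := successor_order_ex infK.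
(* Taking the union over all [b] up to [a] makes [F d] increasing even though
   [cov] need not be monotone. *)
pose F (d : I -> X) a := E (d @` (lt^~ a)) `|` \bigcup_(b in lt^~ a) E (d @` (lt^~ b)).
have [d dE] : exists d : I -> X, forall a, d a = pick (F d a).
  apply: (wf_recursion p wf) => a h h' hh'; rewrite /F.
  have im b : b = a \/ lt b a -> h @` (lt^~ b) = h' @` (lt^~ b).
    move=> ba; apply: eq_imagel => c cb; apply: hh'.
    by case: ba => [<-//|]; exact: tr.
  congr (pick (E _ `|` _)); first by apply: im; left.
  by apply: eq_bigcupr => b ba; rewrite im //; right.
pose D a := d @` (lt^~ a).
have Fle a b : (b = a \/ lt b a) -> E (D b) `<=` F d a.
  by move=> [->|ba] x Ex; [left|right; exists b].
have F_mono a b : lt b a -> F d b `<=` F d a.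
  move=> ba x [Ex|[c cb Ex]]; first by apply: (Fle a b) => //; right.
  by apply: (Fle a c) => //; right; exact: tr ba.
have EH A : A `<=` H -> E A `<=` H.
  by move=> AH x [/AH//|[k _]]; have [_ /(_ x)] := covP (part A k).
have Ecov a : covered K (E (D a)).
  apply: (covered_setU p) => //.
    exact: covered_image (seg a).
  apply: (covered_bigcup p) => //.
    by exists id => k _; exists k.
  by move=> k _; apply: covered_countable => //; have [] := covP (part (D a) k).
have Fcov a : covered K (F d a).
  apply: (covered_setU p) => //; first exact: Ecov.
  by apply: (covered_bigcup p K2 (seg a)) => b _; exact: Ecov.
have DH a : D a `<=` H.
  elim/(well_founded_ind wf): a => a IH _ [b ba <-].
  rewrite dE; apply: (pickP _ _ _).1 => // x [Ex|[c cb Ex]].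
    by apply: EH Ex; exact: IH.
  by apply: EH Ex; apply: IH; exact: tr ba.
have FH a : F d a `<=` H.
  by move=> x [/EH|[b _ /EH]]; apply; exact: DH.
have dF a : ~ hl (F d a) (d a) by rewrite dE; have [] := pickP _ (Fcov a) (FH a).
have dinF a b : lt b a -> F d a (d b).
  by move=> ba; apply: (Fle a a); [left|left; exists b].
(* For [b] before [a] of the same colour, [U (d b)] is among the sets whose
   closure is removed from [U (d a)]. *)
have sdD k : strongly_discrete (part (range d) k).
  have /choice[ix ixP] : forall x, exists a, range d x -> d a = x.
    move=> x; have [[a _ <-]|nx] := pselect (range d x); first by exists a.
    by exists d0.
  pose side x := \bigcup_(y in F d (ix x) `&` [set y | (w y).2 = (w x).2]) U y.
  pose W x := U x `&` ~` closure (side x).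
  have Wlt x y z : range d x -> range d y -> (w x).2 = (w y).2 ->
      lt (ix x) (ix y) -> W x z -> W y z -> False.
    move=> dx dy wxy xy [Ux' _] [_]; apply; apply: subset_closure; exists x => //.
    by split=> //; rewrite -(ixP _ dx); exact: dinF.
  exists W; split=> [x [dx _]|x y [dx xk] [dy yk] [z [Wx Wy]]].
    split; first exact/openI/closed_openC/closed_closure.
    split=> // cx; apply: (dF (ix x)); exists (w x).2 => //.
    by rewrite (ixP _ dx).
  have wxy : (w x).2 = (w y).2 by rewrite xk.
  have [xy|E'|yx] := tri (ix x) (ix y).
  - by case: (Wlt _ _ _ dx dy wxy xy Wx Wy).
  - by rewrite -(ixP _ dx) E' ixP.
  - by case: (Wlt _ _ _ dy dx (esym wxy) yx Wy Wx).
(* By tightness a point of the closure lies in the closure of [K] of the chosen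
   points, and these were all chosen before some stage [a]. *)
have clD k : closure (part (range d) k) `<=`
    \bigcup_(x in \bigcup_(a in [set: I]) F d a) U x.
  move=> x /tightK[B [BD /(card_covered p)[f Bf] cB]].
  have /choice[ix ixP] : forall l, exists a, range d (f l) -> d a = f l.
    move=> l; have [[a _ <-]|nx] := pselect (range d (f l)); first by exists a.
    by exists d0.
  have [a aP] := bnd ix.
  have BDa : B `<=` part (D a) k.
    move=> y By; have [dy yk] := BD _ By; split=> //.
    have [l _ fl] := Bf _ By; exists (ix l); first exact: aP.
    by rewrite ixP ?fl.
  have [_ _ cP] := covP (part (D a) k).
  have [|||y cy Uy] := cP _ _ x.
  - apply: strongly_discrete_sub (sdD k) => y [[b _ <-] yk].
    by split=> //; exists b.
  - by move=> y [/DH].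
  - exact: closureS cB.
  by exists y => //; exists a => //; apply: (Fle a a); [left|right; exists k].
have /choice[S SP] k := SDL_countable_subcover sdlX (sdD k) Uo (clD k).
(* The countable subcovers of all colours together use at most [K] points, so
   they all come from a single [F d a]; but [d a] is in the set of its own
   colour. *)
have [f fS] : covered K (\bigcup_(k in [set: K]) S k).
  apply: (covered_bigcup p) => //; first by exists id => k _; exists k.
  by move=> k _; apply: (covered_countable infK p); have [] := SP k.
have /choice[ix ixP] : forall l, exists a,
    (\bigcup_(a in [set: I]) F d a) (f l) -> F d a (f l).
  move=> l; have [[a _ Fa]|nF] :=
    pselect ((\bigcup_(a in [set: I]) F d a) (f l)); first by exists a.
  by exists d0.
have [a aP] := bnd ix.
have [_ SF /(_ (d a))[]] := SP (w (d a)).2.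
  by apply: subset_closure; split=> //; exists a.
move=> y Sy Uy; apply: (dF a).
have [l _ fl] : range f y by apply: fS; exists (w (d a)).2.
have Fy : F d a y.
  by apply: (F_mono _ _ (aP l)); rewrite -fl; apply: ixP; rewrite fl; exact: SF Sy.
exact: (@sub_hull X id w (F d a) y Fy).
Qed.

Lemma card_le_pow2 (x0 : X) : [set: X] #<= [set: K -> bool].
Proof.
have [H [HC Hx0 Hcl Hhull]] := hull_closed_set x0.
by rewrite -(hull_closed_setT Hx0 Hcl Hhull); exact: covered_card.
Qed.
End cardinality_bound.

(** * Comparison with the character *)

Lemma card_le_pow (A B : Type) :
  [set: A] #<= [set: B] -> [set: A -> bool] #<= [set: B -> bool].
Proof.
move=> /card_leT_inj[f finj].
apply: (@inj_card_leT (A -> bool) (B -> bool)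
  (fun c b => `[< exists2 a, f a = b & c a >])) => c d E.
have sub (c' d' : A -> bool) a : c' a ->
    (fun b => `[< exists2 a, f a = b & c' a >]) =
    (fun b => `[< exists2 a, f a = b & d' a >]) -> d' a.
  move=> ca /(congr1 (fun g => g (f a))) E'.
  have /asboolP[a' /finj -> //] : `[< exists2 a0, f a0 = f a & d' a0 >].
  by rewrite -E'; apply/asboolP; exists a.
apply/funext => a; apply/idP/idP => ca; first exact: sub ca E.
exact: sub ca (esym E).
Qed.

Section comparison_with_character.
Variable X : topologicalType.

Lemma tightness_at_le_card (x : X) (K L : Type) :
  [set: K] #<= [set: L] -> tightness_at_le x K -> tightness_at_le x L.
Proof.
move=> KL tx A /tx[B [BA BK cB]]; exists B; split=> //.
exact: card_le_trans BK KL.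
Qed.

Lemma tightness_at_le_tightness (x : X) : tightness_at_le x (tightness X).
Proof.
have [_ ub _] := infinite_supP (fun x : X => tightness_at x).
by have [_ tx _] := tightness_atP x; exact: tightness_at_le_card tx.
Qed.

Lemma local_base_le_character (x : X) :
  exists2 B, local_base x B & B #<= [set: character X].
Proof.
have [_ ub _] := infinite_supP (fun x : X => character_at x).
have [_ [B Bx cB] _] := character_atP x; exists B => //.
exact: card_le_trans cB (ub x).
Qed.

Lemma infinite_character : infinite_set [set: character X].
Proof. by have [] := infinite_supP (fun x : X => character_at x). Qed.

(** Choosing one point of [A] in each member of a local base at [x] leaves [x]
    in the closure. *)
Lemma tightness_le_character : [set: tightness X] #<= [set: character X].
Proof.
have [_ _] := infinite_supP (fun x : X => tightness_at x).
apply; first exact: infinite_character.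
move=> x; have [_ _] := tightness_atP x; apply; first exact: infinite_character.
move=> A cA; have [B [Bn Bb] cB] := local_base_le_character x.
have /choice[e eP] : forall V, exists y, B V -> (A `&` V) y.
  move=> V; have [BV|nV] := pselect (B V); last by exists x.
  by have [y AVy] := cA _ (open_nbhs_nbhs (Bn _ BV)); exists y.
exists (e @` B); split.
- by move=> _ [V /eP[Ae _] <-].
- exact: card_le_trans (card_image_le _ _) cB.
- move=> V; rewrite nbhsE => -[W xW WV]; have [U BU UW] := Bb _ xW.
  have [_ Ue] := eP _ BU.
  by exists (e U); split; [exists U|exact/WV/UW].
Qed.

(** Local bases of minimal size separate points in a Hausdorff space. *)
Lemma Hpseudocharacter_card_le_character : hausdorff_space X ->
  [set: Hpseudocharacter X] #<= [set: character X].
Proof.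
move=> hX; have [_ _] := HpseudocharacterP hX; apply.
  exact: infinite_character.
have /choice[N NP] : forall x : X, exists B : set (set X),
    local_base x B /\ B #<= [set: character X].
  by move=> x; have [B] := local_base_le_character x; exists B.
exists N; split=> [x|x|x y /eqP xy]; [by have [[]] := NP x|by have [] := NP x|].
move: hX; rewrite open_hausdorff => /(_ _ _ xy)[[U V] /= [/set_mem Ux /set_mem Vy]].
move=> [oU oV /eqP UV].
have [[_ /(_ U)[//|U' NU' U'U]] _] := NP x.
have [[_ /(_ V)[//|V' NV' V'V]] _] := NP y.
exists U', V'; split=> //; apply/seteqP; split=> // z [/U'U Uz /V'V Vz].
by rewrite -UV.
Qed.

End comparison_with_character.

(** The whole space pads a family that has too few members, possibly none, to be
    enumerated by [K]. *)
Lemma Hpseudocharacter_indexed (X : topologicalType) (K : Type) :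
  Hpseudocharacter_le X K -> exists n : X -> K -> set X,
    (forall x k, open_nbhs x (n x k)) /\
    forall x y, x <> y -> exists j k, n x j `&` n y k = set0.
Proof.
move=> [N [Nn NK Nsep]].
have /choice[f fP] : forall x, exists f : K -> set X, N x `<=` range f.
  by move=> x; exact: (card_covered setT (NK x)).
exists (fun x k => if pselect (N x (f x k)) then f x k else setT); split.
  by move=> x k; case: pselect => [Nx|?]; [exact: Nn Nx|exact: open_nbhsT].
move=> x y /Nsep[U [V [NU NV UV]]].
have [j _ jU] := fP _ _ NU; have [k _ kV] := fP _ _ NV.
exists j, k; rewrite jU kV.
by case: pselect => // ?; case: pselect.
Qed.

Unset Implicit Arguments.

Theorem theorem4p1 (X : topologicalType)
    (hausdorffX : hausdorff_space X) (sdlX : SDL_space X) :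
  [set: X] #<= [set: card_pow2 (card_mul (tightness X) (Hpseudocharacter X))] /\
  [set: card_pow2 (card_mul (tightness X) (Hpseudocharacter X))] #<=
    [set: card_pow2 (character X)].
Proof.
have [inft _ _] := infinite_supP (fun x : X => tightness_at x).
have [infh Hle _] := HpseudocharacterP hausdorffX.
have [t0] := infinite_inhabited inft; have [h0] := infinite_inhabited infh.
set K := card_mul _ _.
have tK : [set: tightness X] #<= [set: K].
  by apply: (@inj_card_leT _ K (fun t => (t, h0))) => s t [].
have hK : [set: Hpseudocharacter X] #<= [set: K].
  by apply: (@inj_card_leT _ K (fun h => (t0, h))) => s t [].
have infK : infinite_set [set: K].
  by apply/infiniteP; apply: card_le_trans tK; exact/infiniteP.
split.
  have [[x0]|nX] := pselect (inhabited X); last first.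
    by apply: (@inj_card_leT _ _ (fun=> fun=> true)) => x; case: nX; exists; exact: x.
  have [n [nn nsep]] : exists n : X -> K -> set X,
      (forall x k, open_nbhs x (n x k)) /\
      forall x y, x <> y -> exists j k, n x j `&` n y k = set0.
    apply: Hpseudocharacter_indexed; have [N [Nn NK Nsep]] := Hle.
    by exists N; split=> // x; exact: card_le_trans (NK x) hK.
  apply: (card_le_pow2 infK nn nsep _ sdlX x0) => x.
  exact: tightness_at_le_card tK (@tightness_at_le_tightness X x).
apply: card_le_pow.
have [f finj] := infinite_square (@infinite_character X).
have [g ginj] := card_leT_inj (tightness_le_character X).
have [h hinj] := card_leT_inj (Hpseudocharacter_card_le_character hausdorffX).
by apply: (@inj_card_leT K _ (fun p => f (g p.1, h p.2))) => -[s a] [t b]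
  /finj[/ginj /= -> /hinj ->].
Qed.
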